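(* Consider testing $H_0:\theta=\theta_0$ versus $H_1:\theta=\theta_1$ for some $\theta_0\ne\theta_1\in\Theta$. Let $S_i=\mathrm{supp}(P_{\theta_i})$ for $i=0,1$ and suppose that $S_0\cup S_1$ is $d$-connected. When the observed data $T$ is the output of an $\epsilon$-DP mechanism $M$, the power of any level-$\alpha$ test is bounded above by $\alpha\exp(d_{**}\epsilon)$, where $$d_{**}=\sup_{x\in S_0,\,x'\in S_1}d(x,x').$$ That is, for every rejection region $R\in\mathscr F$ with $P(T\in R\mid\theta_0)\le\alpha$, one has $P(T\in R\mid\theta_1)\le\alpha\exp(d_{**}\epsilon)$.
   Context: $\mathcal X$ (the data universe) carries a metric $d:\mathcal X\times\mathcal X\to[0,\infty]$ (the value $\infty$ is allowed), where $d(x,x')$ is the length of a shortest path between $x$ and $x'$ in a graph on $\mathcal X$ with unit-length edges. $\mathcal X$ and $\mathcal T$ carry second countable topologies (the topology of $\mathcal X$ is not necessarily the one induced by $d$), with Borel $\sigma$-algebras $\mathscr G$ and $\mathscr F$. A data-release mechanism is a $(\mathscr G\otimes\mathcal B[0,1],\mathscr F)$-measurable function $M:\mathcal X\times[0,1]\to\mathcal T$; $P_x(S)=\lambda(\{u\in[0,1]:M(x,u)\in S\})$ for $S\in\mathscr F$, $\lambda$ being Lebesgue measure. For measures $\mu,\nu$ on $(\mathcal T,\mathscr F)$, $d_{\mathrm{Mult}}(\mu,\nu)=\sup_{S\in\mathscr F}|\ln(\mu(S)/\nu(S))|$, with $0/0=\infty/\infty=1$. For $0\le\epsilon<\infty$,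 $M$ is $\epsilon$-DP if $d_{\mathrm{Mult}}(P_x,P_{x'})\le\epsilon\,d(x,x')$ for all $x,x'\in\mathcal X$, with $0\times\infty=\infty$ on the right-hand side. A set $S\subset\mathcal X$ is $d$-connected if $d(x,x')<\infty$ for all $x,x'\in S$. $\{P_\theta:\theta\in\Theta\}$ is a family of probability measures on $(\mathcal X,\mathscr G)$; $P(T\in S\mid\theta)=\int_{\mathcal X}P_x(S)\,dP_\theta(x)$ for $S\in\mathscr F$. $\mathrm{supp}(P_\theta)$ is the intersection of all closed sets $S\subset\mathcal X$ with $P_\theta(S)=1$. *)

(* Defs.v *)
From HB Require Import structures.
From mathcomp Require Import all_boot all_order all_algebra.
From mathcomp Require Import all_classical all_reals all_analysis.

Set Implicit Arguments.
Unset Strict Implicit.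
Unset Printing Implicit Defensive.

Import Order.TTheory GRing.Theory Num.Theory.
Import numFieldNormedType.Exports.

Local Open Scope classical_set_scope.
Local Open Scope ring_scope.
Local Open Scope ereal_scope.

(* [borel X] is [X] itself, equipped with its Borel sigma-algebra. The library
   only builds measurable types on pointed types, whence [ptopologicalType]
   (a topological space with a chosen point) throughout. *)
Notation borel X := (g_sigma_algebraType (@open X)).

Section GraphDistance.
Context {R : realType} {X : choiceType}.
Implicit Types (e : rel X) (A B : set X).

(* [e] is the adjacency relation; [s] lists the vertices after [x], so that
   [size s] is the number of edges. The value is +oo when no path exists. *)
Definition graph_dist e (x x' : X) : \bar R :=
  ereal_inf [set (size s)%:R%:E | s in [set s | path e x s /\ last x s = x']].

Definition dconnected e A :=
  forall x x', A x -> A x' -> graph_dist e x x' < +oo.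

Definition max_dist e A B : \bar R :=
  ereal_sup [set graph_dist e x x' | x in A & x' in B].

End GraphDistance.

(* The quotient with 0/0 = oo/oo = 1. For nonnegative arguments, the library
   quotient has the usual values in the other cases (b/0 = oo, b/oo = 0). *)
Definition eratio {R : realType} (a b : \bar R) : \bar R :=
  if (a == b) && ((a == 0) || (a == +oo)) then 1 else a / b.

(* [lne] sends 0 to -oo and +oo to +oo. *)
Definition dmult {R : realType} {d} {T : measurableType d}
    (mu nu : set T -> \bar R) : \bar R :=
  ereal_sup [set `| lne (eratio (mu S) (nu S)) | | S in measurable].

(* eps * D, with 0 * oo = oo, whereas the library has 0 * oo = 0. *)
Definition dp_bound {R : realType} (eps : R) (D : \bar R) : \bar R :=
  if D == +oo then +oo else eps%:E * D.

Section Mechanism.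
Context {R : realType} {X T : ptopologicalType}.

(* A mechanism is represented by a function on X * R of which only the values
   on X * [0, 1] matter. *)
Implicit Type M : X * R -> T.

Definition mechanism M :=
  measurable_fun ([set: borel X] `*` (`[0%R, 1%R] : set R))
    (M : borel X * R -> borel T).

Definition mech_prob M (x : X) (S : set (borel T)) : \bar R :=
  lebesgue_measure [set u : R | u \in `[0%R, 1%R] /\ S (M (x, u))].

Definition dp e (eps : R) M :=
  forall x x', dmult (mech_prob M x) (mech_prob M x')
               <= dp_bound eps (graph_dist e x x').

Definition data_prob M (P : probability (borel X) R) (S : set (borel T)) :
    \bar R :=
  \int[P]_x mech_prob M x S.

Definition prob_supp (P : probability (borel X) R) : set X :=
  \bigcap_(S in [set S : set X | closed S /\ P S = 1]) S.

End Mechanism.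

(* Main.v *)
Require Import Defs.
From HB Require Import structures.
From mathcomp Require Import all_boot all_order all_algebra.
From mathcomp Require Import all_classical all_reals all_analysis.
From mathcomp Require Import measurable_realfun.

(** Write [f x] for the probability that the output of the mechanism on the
    database [x] falls in the rejection region, and [K] for [max_dist * eps].
    Differential privacy, applied to the single event of rejection, gives the
    pointwise bound [f x' <= f x * expeR K] for every [x] in the support of
    [P theta0] and every [x'] in the support of [P theta1]; connectedness of
    the union of the supports is what makes every distance finite, so that
    privacy says something about each pair ([mech_prob_le_of_dp]). By second
    countability each support carries full probability ([ae_prob_supp]), so the
    pointwise bound can be averaged, first over [x] under [P theta0], which
    turns [f x] into the probability of a false rejection, and then over [x']
    under [P theta1], which turns [f x'] into the power.

    The case [K = +oo] is separate. If [0 < alpha] the bound is trivial. If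
    [alpha = 0] its value is [0 * +oo = 0], and the power must be shown to
    vanish: [f] is null almost everywhere under [P theta0], hence at some point
    of its support, and the pointwise bound carries this zero to the whole
    support of [P theta1]. *)

Set Implicit Arguments.
Unset Strict Implicit.
Unset Printing Implicit Defensive.

Import Order.TTheory GRing.Theory Num.Theory.
Import numFieldNormedType.Exports.

Local Open Scope classical_set_scope.
Local Open Scope ring_scope.
Local Open Scope ereal_scope.

(** * Supports of Borel probabilities *)

Section Support.
Context {R : realType} {X : ptopologicalType}.

Lemma borel_open_measurable (U : set X) :
  open U -> measurable (U : set (borel X)).
Proof. by move=> oU; apply: sub_sigma_algebra. Qed.

Lemma borel_closed_measurable (C : set X) :
  closed C -> measurable (C : set (borel X)).
Proof.
move=> cC; rewrite -[C]setCK; apply: measurableC.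
by apply: borel_open_measurable; rewrite openC.
Qed.

(** The complement of the support is the union of the null members of a
    countable basis. *)
Lemma ae_prob_supp (P : probability (borel X) R) :
  @second_countable X -> {ae P, forall x, prob_supp P x}.
Proof.
move=> [B cB [Bo Bb]].
pose N := [set U : set X | B U /\ P U = 0].
have cN : countable N by apply: sub_countable cB; apply: subset_card_le => U [].
change (P.-negligible (~` prob_supp P)).
have -> : ~` prob_supp P = \bigcup_(U in N) U.
  apply/seteqP; split=> x.
    rewrite /prob_supp setC_bigcap => -[S [cS PS] nSx].
    have oS : open (~` S) by rewrite openC.
    have [U [BU Ux] US] := Bb x _ (open_nbhs_nbhs (conj oS nSx)).
    exists U => //; split=> //; apply/eqP.
    rewrite eq_le measure_ge0 andbT.
    have <- : P (~` S) = 0.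
      rewrite probability_setC; last exact: borel_closed_measurable.
      by rewrite PS subee.
    apply: le_measure => //; rewrite inE; apply: borel_open_measurable => //.
    exact: Bo.
  move=> [U [BU PU] Ux] Sx.
  have cU : closed (~` U) by apply: open_closedC; exact: Bo.
  apply: (Sx (~` U)) => //; split=> //.
  have mU : measurable (U : set (borel X)).
    by apply: borel_open_measurable; exact: Bo.
  by rewrite probability_setC // PU sube0.
have [->|[f]] := pfcard_geP cN.
  by rewrite bigcup_set0; exact: negligible_set0.
have -> : \bigcup_(U in N) U = \bigcup_n f n.
  apply/seteqP; split=> [x [U NU Ux]|x [n _ fx]].
    by have [n _ fU] := @surj _ _ _ _ f U NU; exists n => //; rewrite fU.
  by exists (f n) => //; exact: funS.
apply: negligible_bigcup => n.
have [Bf Pf] : N (f n) by exact: funS.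
by apply/negligibleP => //; apply: borel_open_measurable; exact: Bo.
Qed.

End Support.

(** * Output distributions of a mechanism *)

Section Mechanism.
Context {R : realType} {X T : ptopologicalType}.
Context (M : X * R -> T) (mM : mechanism M).

(** The pairs of a database and a seed in [0, 1] whose output lies in [S]; the
    output distribution is read off its sections. *)
Let accept (S : set (borel T)) : set (borel X * R) :=
  ([set: borel X] `*` (`[0%R, 1%R] : set R)) `&` M @^-1` S.

Let mech_probE S : (fun x => mech_prob M x S) =
  (@lebesgue_measure R) \o xsection (accept S).
Proof.
apply/funext => x; rewrite /mech_prob /=; congr (_ _).
apply/seteqP; split=> u.
  by move=> [/= u01 Su]; apply/xsectionP.
by move/xsectionP => [[_ /= u01] Su].
Qed.

Let measurable_accept S : measurable S -> measurable (accept S).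
Proof. by move=> mS; apply: mM => //; apply: measurableX. Qed.

Lemma measurable_fun_mech_prob S : measurable S ->
  measurable_fun [set: borel X] ((mech_prob M)^~ S : borel X -> \bar R).
Proof.
move=> mS; rewrite mech_probE.
exact: (@measurable_fun_xsection _ _ _ _ R (@lebesgue_measure R) _
  (measurable_accept mS)).
Qed.

Lemma mech_prob_ge0 x S : 0 <= mech_prob M x S.
Proof. exact: measure_ge0. Qed.

Lemma mech_prob_fin_num x S : measurable S -> mech_prob M x S \is a fin_num.
Proof.
move=> mS; rewrite ge0_fin_numE ?mech_prob_ge0 //.
have -> : mech_prob M x S = lebesgue_measure (xsection (accept S) x).
  by have := congr1 (fun f => f x) (mech_probE S).
apply: (@le_lt_trans _ _ (lebesgue_measure (`[0%R, 1%R] : set R))).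
  apply: le_measure; rewrite ?inE //.
    exact: measurable_xsection (measurable_accept mS).
  by move=> u /xsectionP[[_ +] _].
by rewrite lebesgue_measure_itv /= lte_fin ltr01 ltry.
Qed.

End Mechanism.

(** * Pointwise consequences of differential privacy *)

Section Ratio.
Context {R : realType}.

Lemma graph_dist_ge0 (X : choiceType) (e : rel X) (x x' : X) :
  0 <= graph_dist e x x' :> \bar R.
Proof. by apply: le_ereal_inf_tmp => _ [s _ <-]; rewrite lee_fin. Qed.

(** The case [a = 0 < b] is excluded by the hypothesis, the left-hand side being
    infinite. *)
Lemma lne_eratio_le (a b c : R) : (0 <= a)%R -> (0 <= b)%R ->
  `| lne (eratio a%:E b%:E) | <= c%:E -> (b <= a * expR c)%R.
Proof.
move=> a0 b0; have [->|bn0] := eqVneq b 0%R.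
  by move=> _; rewrite mulr_ge0 // expR_ge0.
have bp : (0 < b)%R by rewrite lt_neqAle eq_sym bn0.
have [->|an0] := eqVneq a 0%R.
  rewrite /eratio eqe eq_sym (negbTE bn0) /= mul0e /=.
  by rewrite lexx.
have ap : (0 < a)%R by rewrite lt_neqAle eq_sym an0.
have abp : (0 < a / b)%R by rewrite divr_gt0.
have lnab : `|lne (eratio a%:E b%:E)| = `|ln (a / b)|%:E.
  rewrite /eratio !eqe (negbTE an0) /= andbF.
  by rewrite inver (negbTE bn0) -EFinM lne_EFin.
rewrite lnab lee_fin => /ler_normlP[+ _].
rewrite ln_div ?posrE // opprB lerBlDr => lnb.
by rewrite -[b]lnK ?posrE // -{1}[a]lnK ?posrE // mulrC -expRD ler_expR //.
Qed.

(** Differential privacy of a single event, for a pair at finite distance. *)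
Lemma mech_prob_le_of_dp (X T : ptopologicalType) (e : rel X) (eps : R)
    (M : X * R -> T) (S : set (borel T)) (x x' : X) :
  mechanism M -> dp e eps M -> measurable S ->
  graph_dist e x x' < (+oo : \bar R) ->
  mech_prob M x' S <= mech_prob M x S * expeR (graph_dist e x x' * eps%:E).
Proof.
move=> mM hdp mS dfin.
have d_fin : graph_dist e x x' \is a @fin_num R.
  by rewrite ge0_fin_numE // graph_dist_ge0.
have := hdp x x'; rewrite /dp_bound (lt_eqF dfin).
rewrite -(fineK d_fin); set d := fine _.
have ea := fineK (mech_prob_fin_num mM x mS).
have eb := fineK (mech_prob_fin_num mM x' mS).
rewrite -ea -eb -EFinM /= -EFinM lee_fin => h.
apply: lne_eratio_le; rewrite ?fine_ge0 ?mech_prob_ge0 //.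
rewrite ea eb mulrC EFinM; apply: le_trans h.
by apply: ereal_sup_ubound; exists S.
Qed.

End Ratio.

(** * Integrals against a probability *)

Section Expectation.
Context {R : realType} {d} {T : measurableType d} (P : probability T R).
Context (f : T -> \bar R) (c : \bar R).
Context (f0 : forall x, 0 <= f x) (mf : measurable_fun [set: T] f).

Let integral_prob_cst : \int[P]_x cst c x = c.
Proof.
rewrite integral_cst // -[RHS]mule1; congr (_ * _); exact: probability_setT.
Qed.

Lemma ae_ge_cst_integral : 0 <= c ->
  {ae P, forall x, c <= f x} -> c <= \int[P]_x f x.
Proof.
move=> c0 cf; rewrite -[leLHS]integral_prob_cst.
apply: ae_ge0_le_integral => //.
by apply: filterS cf => x cfx _.
Qed.

Lemma ae_le_cst_integral : 0 <= c ->
  {ae P, forall x, f x <= c} -> \int[P]_x f x <= c.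
Proof.
move=> c0 fc; rewrite -[leRHS]integral_prob_cst.
apply: ae_ge0_le_integral => //.
by apply: filterS fc => x fcx _.
Qed.

Lemma integral_eq0_ae : \int[P]_x f x = 0 -> {ae P, forall x, f x = 0}.
Proof.
move=> f_eq0.
have /(ae_eq_integral_abs P measurableT mf) : \int[P]_x `|f x| = 0.
  by rewrite -[RHS]f_eq0; apply: eq_integral => x _; rewrite gee0_abs.
by apply: filterS => x /(_ I).
Qed.

End Expectation.

Lemma probability_ae_ex {R : realType} {d} {T : measurableType d}
    (P : probability T R) (Q : T -> Prop) :
  {ae P, forall x, Q x} -> exists x, Q x.
Proof.
have P0 : 0 < P [set: T] by rewrite [X in _ < X]probability_setT lte01.
have := ae_properfilter_algebraOfSetsType P0.
by move=> ? /filter_ex.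
Qed.

(** * The power bound *)

Theorem theorem11 (R : realType) (X T : ptopologicalType)
    (hX : @second_countable X) (hT : @second_countable T)
    (e : rel X) (he : symmetric e)
    (Theta : Type) (P : Theta -> probability (borel X) R)
    (M : X * R -> T) (hM : mechanism M)
    (eps : R) (heps : (0 <= eps)%R) (hdp : dp e eps M)
    (theta0 theta1 : Theta) (hne : theta0 <> theta1)
    (hconn : @dconnected R X e
               (prob_supp (P theta0) `|` prob_supp (P theta1)))
    (alpha : R) (Rej : set (borel T)) (hRej : measurable Rej)
    (hlevel : data_prob M (P theta0) Rej <= alpha%:E) :
  data_prob M (P theta1) Rej <=
    alpha%:E *
    expeR (max_dist e (prob_supp (P theta0)) (prob_supp (P theta1)) * eps%:E).
Proof.
have s0 := ae_prob_supp (P theta0) hX.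
have s1 := ae_prob_supp (P theta1) hX.
have F0 := ae_filter_ringOfSetsType (P theta0).
have F1 := ae_filter_ringOfSetsType (P theta1).
have mf := measurable_fun_mech_prob hM hRej.
have f0 x : 0 <= mech_prob M x Rej by exact: mech_prob_ge0.
have alpha0 : 0 <= alpha%:E by apply: le_trans hlevel; exact: integral_ge0.
set K := max_dist _ _ _ * _.
apply: ae_le_cst_integral => //.
  by rewrite mule_ge0 // expeR_ge0.
apply: filterS s1 => x' s1x'.
have pair x : prob_supp (P theta0) x ->
    mech_prob M x' Rej <= mech_prob M x Rej * expeR K.
  move=> s0x.
  apply: (le_trans (mech_prob_le_of_dp hM hdp hRej (hconn x x' _ _))).
  - by left.
  - by right.
  apply: lee_wpmul2l => //; rewrite lee_expeR lee_wpmul2r ?lee_fin //.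
  by apply: ereal_sup_ubound; exists x => //; exists x'.
have [Ky|Ky] := eqVneq K +oo; last first.
  (* [expeR K] is a positive real, by which the pointwise bound is divided
     before it is integrated over [x]. *)
  have Kfin : expeR K \is a fin_num.
    by rewrite ge0_fin_numE ?expeR_ge0 // ltey expeR_eqy.
  have K0 : 0 < expeR K.
    (* [K] could only be [-oo] as a supremum over an empty set of pairs. *)
    have [x s0x] := probability_ae_ex s0.
    apply: expeR_gt0; apply: (@lt_le_trans _ _ 0); first exact: ltNyr.
    apply: mule_ge0; last by rewrite lee_fin.
    apply: le_ereal_sup_tmp.
    exists (graph_dist e x x'); last exact: graph_dist_ge0.
    by exists x => //; exists x'.
  move: pair K0; rewrite -(fineK Kfin); set k := fine _ => pair.
  rewrite lte_fin => k0; rewrite -lee_pdivrMr //.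
  apply: le_trans hlevel; apply: ae_ge_cst_integral => //.
    by rewrite mule_ge0 // lee_fin invr_ge0 ltW.
  by apply: filterS s0 => x /pair; rewrite lee_pdivrMr.
rewrite Ky /=; move: alpha0; rewrite le_eqVlt => /predU1P[a0|a0]; last first.
  by rewrite gt0_muley // leey.
(* Remaining case: [alpha = 0] and [K = +oo]. *)
rewrite -a0 mul0e.
have /integral_eq0_ae z : \int[P theta0]_x mech_prob M x Rej = 0.
  by apply/eqP; rewrite eq_le integral_ge0 // andbT a0.
have [x [s0x fx0]] : exists x, prob_supp (P theta0) x /\ mech_prob M x Rej = 0.
  by apply: (@probability_ae_ex _ _ _ (P theta0)); apply: filterS2 s0 (z f0 mf).
by apply: le_trans (pair x s0x) _; rewrite fx0 mul0e.
Qed.
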